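(* Let $\mathbf{s}=(s_1,\ldots,s_r)$ be integers greater than $1$, $G=\mathbb{Z}_{s_1}\times\cdots\times\mathbb{Z}_{s_r}$, $\phi:G\to\{\pm1\}$, and $\mathbf{z}\in\{0,1\}^r$. With $E,H,K,\phi'$ as in the context, for every $g\in E$, \[R_{\phi'}(g)=|H|\sum_{x\in T}\phi'(x)\phi'(x+g),\] where $T$ is any transversal for $H$ in $E$.
   Context: Cyclic groups are written additively. $E=\mathbb{Z}_{(z_1+1)s_1}\times\cdots\times\mathbb{Z}_{(z_r+1)s_r}$, $H=\{h\in E : h_i=0 \text{ if } z_i=0,\ h_i\in\{0,s_i\}\text{ if } z_i=1\}$, $K=\{k\in H: k \text{ has an even number of nonzero coordinates}\}$. For $g\in E$ let $a$ be $g$ reduced modulo $\mathbf{s}$ coordinatewise (viewed in $G$ and in $E$ with coordinates in $\{0,\ldots,s_i-1\}$); the expansion is $\phi'(g)=\phi(a)$ if $g\in a+K$, and $-\phi(a)$ otherwise. For an array $\varphi:A\to\{\pm1\}$ on a finite abelian group $A$, $R_\varphi(x)=\sum_{y\in A}\varphi(y)\varphi(y+x)$. *)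

(* Defs.v *)
From HB Require Import structures.
From mathcomp Require Import all_boot all_order all_algebra.

Set Implicit Arguments.
Unset Strict Implicit.
Unset Printing Implicit Defensive.

Import GRing.Theory.
Local Open Scope ring_scope.

(* The direct product of the cyclic groups Z_(m i). Since 'Z_n stands for Z/2Z
   when n <= 1, this is the intended group only if all the m i are > 1. *)
Definition prodZ (r : nat) (m : 'I_r -> nat) : Type :=
  {dffun forall i : 'I_r, 'Z_(m i)}.

Section ProdZ.
Variables (r : nat) (m : 'I_r -> nat).
Implicit Types f g h : prodZ m.

HB.instance Definition _ := Finite.copy (prodZ m)
  {dffun forall i : 'I_r, 'Z_(m i)}.

Definition prodZ_zero : prodZ m := [ffun i : 'I_r => 0 : 'Z_(m i)].
Definition prodZ_opp f : prodZ m := [ffun i : 'I_r => - f i : 'Z_(m i)].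
Definition prodZ_add f g : prodZ m := [ffun i : 'I_r => f i + g i : 'Z_(m i)].

Fact prodZ_addA : associative prodZ_add.
Proof. by move=> f g h; apply/ffunP => i; rewrite !ffunE addrA. Qed.
Fact prodZ_addC : commutative prodZ_add.
Proof. by move=> f g; apply/ffunP => i; rewrite !ffunE addrC. Qed.
Fact prodZ_add0 : left_id prodZ_zero prodZ_add.
Proof. by move=> f; apply/ffunP => i; rewrite !ffunE add0r. Qed.
Fact prodZ_addN : left_inverse prodZ_zero prodZ_opp prodZ_add.
Proof. by move=> f; apply/ffunP => i; rewrite !ffunE addNr. Qed.

HB.instance Definition _ := GRing.isZmodule.Build (prodZ m)
  prodZ_addA prodZ_addC prodZ_add0 prodZ_addN.

End ProdZ.

Definition is_pm1_valued (A : Type) (phi : A -> int) : Prop :=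
  forall x, phi x = 1 \/ phi x = -1.

Definition autocorrelation (A : finZmodType) (phi : A -> int) (x : A) : int :=
  \sum_(y : A) phi y * phi (y + x).

Definition coset_add (A : finZmodType) (x : A) (B : {set A}) : {set A} :=
  [set x + b | b in B].

Definition is_transversal_for (A : finZmodType) (B T : {set A}) : bool :=
  is_transversal T [set coset_add x B | x : A] [set: A].

Section Expansion.
Variables (r : nat) (s : 'I_r -> nat) (z : 'I_r -> bool).

(* The boolean z i is read as the natural number 0 or 1. *)
Definition Emod (i : 'I_r) : nat := ((z i + 1) * s i)%N.

Definition Hset : {set prodZ Emod} :=
  [set h : prodZ Emod | [forall i : 'I_r,
     if z i then (h i == 0) || (h i == (s i)%:R) else h i == 0]].

Definition Kset : {set prodZ Emod} :=
  [set k in Hset | ~~ odd #|[set i : 'I_r | k i != 0]|].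

Definition reduce (g : prodZ Emod) : prodZ s :=
  [ffun i : 'I_r => (nat_of_ord (g i))%:R : 'Z_(s i)].

(* a : G viewed in E through its representatives in {0, ..., s i - 1}; this is
   not a group morphism. *)
Definition lift_rep (a : prodZ s) : prodZ Emod :=
  [ffun i : 'I_r => (nat_of_ord (a i))%:R : 'Z_(Emod i)].

Definition expansion (phi : prodZ s -> int) (g : prodZ Emod) : int :=
  let a := reduce g in
  if g \in coset_add (lift_rep a) Kset then phi a else - phi a.

End Expansion.

(* Main.v *)
Require Import Defs.
From mathcomp Require Import all_boot all_order all_algebra.

Set Implicit Arguments.
Unset Strict Implicit.
Unset Printing Implicit Defensive.

Import GRing.Theory.
Local Open Scope ring_scope.

(** Translating the argument by h in H multiplies the expansion by the sign
    (-1)^k, where k is the number of nonzero coordinates of h; this sign is a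
    character of H because each coordinate of H is a group of order at most 2.
    So [phi'(x) phi'(x + g)] is constant on the cosets of H, and the sum over E
    collapses to a transversal. *)

Lemma in_coset_add (A : finZmodType) (x y : A) (B : {set A}) :
  (y \in coset_add x B) = (y - x \in B).
Proof.
apply/imsetP/idP => [[b bB ->]|yxB]; first by rewrite addrC addKr.
by exists (y - x); rewrite // addrC subrK.
Qed.

(** Each coset of [B] has [#|B|] elements, on which [F] is constant, and contains exactly one point
    of [T]. *)
Lemma sum_coset_invariant (R : pzRingType) (A : finZmodType) (B T : {set A})
    (F : A -> R) :
  zmod_closed B -> is_transversal_for B T ->
  (forall x b, b \in B -> F (x + b) = F x) ->
  \sum_x F x = #|B|%:R * \sum_(x in T) F x.
Proof.
move=> [_ subB] /and3P[partB _ /forall_inP T1] FB.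
have partT (G : A -> R) : \sum_x G x =
    \sum_(C in [set coset_add x B | x : A]) \sum_(x in C) G x.
  by rewrite -(set_partition_big _ partB); apply: eq_bigl => x; rewrite inE.
(* Extending the sum over [T] by zero to all of [A] lets both sides split along the same partition,
   so they are compared coset by coset. *)
rewrite [X in _ = _ * X]big_mkcond !partT mulr_sumr; apply: eq_bigr => C CP.
have /cards1P[t TC] := T1 C CP.
have : t \in T :&: C by rewrite TC set11.
rewrite inE => /andP[tT tC].
case/imsetP: CP tC TC => c _ ->; set C' := coset_add c B => tC TC.
rewrite -big_mkcondr (eq_bigl (mem [set t])); last first.
  by move=> x; rewrite -TC !inE andbC.
rewrite big_set1.
have FC x : x \in C' -> F x = F t.
  (* Both [x - c] and [t - c] lie in [B], hence so does their difference. *)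
  move=> xC; have -> : x = t + ((x - c) - (t - c)).
    by rewrite opprB subrKA addrC subrK.
  by rewrite FB //; apply: subB; rewrite -in_coset_add.
rewrite (eq_bigr _ FC) sumr_const mulr_natl /C' card_imset //.
exact: addrI.
Qed.

Section Expansion.
Variables (r : nat) (s : 'I_r -> nat) (z : 'I_r -> bool).
Hypothesis s_gt1 : forall i, (1 < s i)%N.
Local Notation E := (prodZ (Emod s z)).

Definition weight_parity (h : E) : bool := odd #|[set i | h i != 0]|.

Let Emod_gt1 i : (1 < Emod s z i)%N.
Proof. by rewrite /Emod (leq_trans (s_gt1 i)) // leq_pmull // addn1. Qed.

Let val_natE i n : ((n%:R : 'Z_(Emod s z i)) : nat) = (n %% Emod s z i)%N.
Proof. by rewrite val_Zp_nat. Qed.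

Let HsetP (h : E) : reflect
  (forall i, if z i then (h i == 0) || (h i == (s i)%:R) else h i == 0)
  (h \in Hset s z).
Proof. by rewrite inE; apply: forallP. Qed.

(** When [z i] holds the modulus is twice [s i], so [s i] is the element of order 2. *)
Let s_neq0 i : z i -> (s i)%:R != 0 :> 'Z_(Emod s z i).
Proof.
move=> zi; apply/eqP => /(congr1 val); rewrite /= val_natE modn_small.
  by move=> s0; have := s_gt1 i; rewrite s0.
by rewrite /Emod zi mul2n -addnn -[ltnLHS]addn0 ltn_add2l ltnW.
Qed.

Let s_double i : z i -> (s i)%:R + (s i)%:R = 0 :> 'Z_(Emod s z i).
Proof.
move=> zi; rewrite -natrD; apply: val_inj; rewrite /= val_natE.
by rewrite /Emod zi mul2n addnn modnn.
Qed.

Let Hset_opp (h : E) : h \in Hset s z -> - h = h.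
Proof.
move=> /HsetP hH; apply/ffunP => i; rewrite ffunE; have := hH i.
case: ifP => [zi /orP[]|_] /eqP->; rewrite ?oppr0 //.
by apply/eqP; rewrite eq_sym -addr_eq0 s_double.
Qed.

Let Hset_add (h k : E) :
  h \in Hset s z -> k \in Hset s z -> h + k \in Hset s z.
Proof.
move=> /HsetP hH /HsetP kH; apply/HsetP => i.
rewrite ffunE; move: (hH i) (kH i); case: ifP => [zi|_]; last first.
  by move=> /eqP-> /eqP->; rewrite addr0.
by case/orP=> /eqP-> /orP[]/eqP->; rewrite ?addr0 ?add0r ?s_double ?eqxx ?orbT.
Qed.

Lemma Hset_zmod_closed : zmod_closed (Hset s z).
Proof.
split=> [|h k hH kH]; last by rewrite (Hset_opp kH) Hset_add.
by apply/HsetP => i; rewrite ffunE eqxx; case: ifP.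
Qed.

(** Writing the parity as an exclusive or over coordinates reduces its additivity on H to one
    coordinate at a time. *)
Let weight_parityE (h : E) :
  weight_parity h = \big[addb/false]_i (h i != 0).
Proof.
rewrite /weight_parity -sum1_card (big_morph odd oddD (erefl _)) big_mkcond.
by apply: eq_bigr => i _; rewrite inE; case: (_ != _).
Qed.

Lemma weight_parityD (h k : E) : h \in Hset s z -> k \in Hset s z ->
  weight_parity (h + k) = weight_parity h (+) weight_parity k.
Proof.
move=> /HsetP hH /HsetP kH; rewrite !weight_parityE -big_split.
apply: eq_bigr => i _ /=; rewrite ffunE; move: (hH i) (kH i).
case: ifP => [zi|_]; last by move=> /eqP-> /eqP->; rewrite addr0 eqxx.
by case/orP=> /eqP-> /orP[]/eqP->;
  rewrite ?addr0 ?add0r ?s_double ?eqxx ?s_neq0.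
Qed.

(** Coordinates of H are multiples of [s i], and a wrap-around modulo [Emod s z i] is invisible
    modulo its divisor [s i]. *)
Lemma reduceD (g h : E) : h \in Hset s z -> reduce (g + h) = reduce g.
Proof.
move=> /HsetP hH; apply/ffunP => i; rewrite !ffunE; apply: val_inj.
have s_dvd : (s i %| Emod s z i)%N by rewrite /Emod dvdn_mull.
rewrite /= !val_Zp_nat // [X in (_ %% X %% _)%N]Zp_cast //.
rewrite modn_dvdm // -modnDmr.
suff -> : (h i %% s i = 0)%N by rewrite addn0.
have := hH i; case: ifP => [zi /orP[]|_] /eqP->; rewrite ?mod0n //.
by rewrite val_natE modn_dvdm // modnn.
Qed.

Lemma sub_lift_reduce_in_Hset (g : E) :
  g - lift_rep z (reduce g) \in Hset s z.
Proof.
apply/HsetP => i; rewrite !ffunE val_Zp_nat //.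
have gE : g i = (g i : nat)%:R by rewrite natr_Zp.
have g_lt : (g i < Emod s z i)%N by rewrite -[ltnRHS]Zp_cast.
(* Euclidean division is applied to the minuends only, so the remainders cancel and the quotient
   times [s i] is left; that quotient is 0, or possibly 1 when [z i] holds. *)
rewrite {1 3 5}gE {1 3 5}(divn_eq (g i) (s i)) natrD addrK.
have: (g i %/ s i < z i + 1)%N by rewrite ltn_divLR // ltnW.
case: ifP => _; case: (g i %/ s i)%N => [|[|n]] // _; rewrite ?mul0n ?eqxx //.
by rewrite mul1n eqxx orbT.
Qed.

(** As [g] minus its lifted reduction always lies in H, membership in the coset of K is decided by
    parity alone. *)
Lemma expansionE (phi : prodZ s -> int) (g : E) :
  expansion phi g =
    (-1) ^+ weight_parity (g - lift_rep z (reduce g)) * phi (reduce g).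
Proof.
rewrite /expansion in_coset_add inE sub_lift_reduce_in_Hset /=.
by rewrite /weight_parity; case: (odd _); rewrite ?mulN1r ?mul1r.
Qed.

Lemma expansion_addH (phi : prodZ s -> int) (g h : E) : h \in Hset s z ->
  expansion phi (g + h) = (-1) ^+ weight_parity h * expansion phi g.
Proof.
move=> hH; rewrite !expansionE reduceD // addrAC.
rewrite (weight_parityD _ hH) ?sub_lift_reduce_in_Hset // signr_addb.
by rewrite mulrCA mulrA.
Qed.

End Expansion.

Theorem corollary1 (r : nat) (s : 'I_r -> nat) (hs : forall i, (1 < s i)%N)
    (phi : prodZ s -> int) (hphi : is_pm1_valued phi) (z : 'I_r -> bool)
    (T : {set prodZ (Emod s z)}) (hT : is_transversal_for (Hset s z) T)
    (g : prodZ (Emod s z)) :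
  autocorrelation (expansion phi) g =
    #|Hset s z|%:R * \sum_(x in T) expansion phi x * expansion phi (x + g).
Proof.
apply: sum_coset_invariant => // [|x h hH]; first exact: Hset_zmod_closed.
(* Both factors acquire the same sign, whose square is 1. *)
by rewrite addrAC !(expansion_addH _ _ _ hH) // mulrACA -signr_addb addbb mul1r.
Qed.
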